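(* Let $\mu,\nu\in\mathcal{P}([0,1])$ and let $c:[0,1]^2\to\mathbb{R}_+$ be a Lipschitz function with Lipschitz constant $K>0$, i.e. $|c(x,y)-c(x',y')|\le K\max(|x-x'|,|y-y'|)$ for all $(x,y),(x',y')\in[0,1]^2$. Let $I=\inf_{\pi\in\Pi(\mu,\nu)}\int_{[0,1]^2}c\,d\pi$ and, for $N\in\mathbb{N}^*$, $$I^N=\inf\left\{\int_{[0,1]^2}c(x,y)\,d\pi(x,y)\;:\;\pi\in\Pi(\mu,\nu;(\phi^N_m)_{1\le m\le N},(\phi^N_n)_{1\le n\le N})\right\},\qquad\phi^N_m=\mathbf{1}_{T^N_m}.$$ Then, for all $N\in\mathbb{N}^*$, $$I^N\le I\le I^N+\frac{K}{N}.$$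
   Context: $\mathbb{N}^*=\{1,2,\dots\}$. For $N\in\mathbb{N}^*$, $T^N_1=[0,\frac1N]$ and $T^N_m=(\frac{m-1}{N},\frac mN]$ for $2\le m\le N$. $\mathcal{P}(E)$ is the set of Borel probability measures on $E$. $\Pi(\mu,\nu)$ is the set of probability measures on $[0,1]^2$ with marginal laws $\mu$ and $\nu$. $\Pi(\mu,\nu;(\phi^N_m)_{1\le m\le N},(\phi^N_n)_{1\le n\le N})$ is the set of $\pi\in\mathcal{P}([0,1]^2)$ such that for all $1\le m,n\le N$, $\int\phi^N_m(x)\,d\pi(x,y)=\int\phi^N_m\,d\mu$ and $\int\phi^N_n(y)\,d\pi(x,y)=\int\phi^N_n\,d\nu$. *)

(* Defs.v *)
From HB Require Import structures.
From mathcomp Require Import all_boot all_order all_algebra.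
From mathcomp Require Import all_classical all_reals all_analysis.

Set Implicit Arguments.
Unset Strict Implicit.
Unset Printing Implicit Defensive.

Import Order.TTheory GRing.Theory Num.Theory.
Import numFieldNormedType.Exports.

Local Open Scope classical_set_scope.
Local Open Scope ring_scope.
Local Open Scope ereal_scope.

(* A Borel probability measure on [0,1] (resp. [0,1]^2) is represented by a
   Borel probability measure on R (resp. R * R) giving mass 1 to [0,1]
   (resp. [0,1]^2).  Correspondingly a function on [0,1] or [0,1]^2 is a total
   function whose values outside that set are never used. *)

Definition unit_itv (R : realType) : set R := `[0%R, 1%R]%classic.

Definition unit_square (R : realType) : set (R * R) :=
  @unit_itv R `*` @unit_itv R.

Definition on_unit_itv (R : realType) (mu : probability (measurableTypeR R) R)
  : Prop := mu (@unit_itv R) = 1.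

Definition on_unit_square (R : realType)
    (pi : probability (measurableTypeR R * measurableTypeR R)%type R) : Prop :=
  pi (@unit_square R) = 1.

Definition couplings (R : realType)
    (mu nu : probability (measurableTypeR R) R)
  : set (probability (measurableTypeR R * measurableTypeR R)%type R) :=
  [set pi | [/\ on_unit_square pi,
    forall A : set (measurableTypeR R), measurable A ->
      pushforward pi fst A = mu A &
    forall A : set (measurableTypeR R), measurable A ->
      pushforward pi snd A = nu A]].

(* The families of test functions are indexed from 1 to N. *)
Definition moment_couplings (R : realType)
    (mu nu : probability (measurableTypeR R) R)
    (N : nat) (phi psi : nat -> R -> R)
  : set (probability (measurableTypeR R * measurableTypeR R)%type R) :=
  [set pi | on_unit_square pi /\
    forall m n : nat, (1 <= m <= N)%N -> (1 <= n <= N)%N ->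
      \int[pi]_(p in @unit_square R) (phi m p.1)%:E
        = \int[mu]_(x in @unit_itv R) (phi m x)%:E /\
      \int[pi]_(p in @unit_square R) (psi n p.2)%:E
        = \int[nu]_(y in @unit_itv R) (psi n y)%:E].

Definition cell (R : realType) (N m : nat) : set R :=
  if m == 1%N then `[0%R, (N%:R^-1)%R]%classic
  else `](m.-1%:R / N%:R)%R, (m%:R / N%:R)%R]%classic.

Definition cell_indic (R : realType) (N m : nat) : R -> R :=
  \1_(@cell R N m).

Definition cost (R : realType) (c : R * R -> R)
    (pi : probability (measurableTypeR R * measurableTypeR R)%type R) : \bar R :=
  \int[pi]_(p in @unit_square R) (c p)%:E.

Definition OT (R : realType) (mu nu : probability (measurableTypeR R) R)
    (c : R * R -> R) : \bar R :=
  ereal_inf [set cost c pi | pi in couplings mu nu].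

Definition MCOT (R : realType) (mu nu : probability (measurableTypeR R) R)
    (c : R * R -> R) (N : nat) : \bar R :=
  ereal_inf [set cost c pi |
    pi in moment_couplings mu nu N (@cell_indic R N) (@cell_indic R N)].

(* Main.v *)
(** Restricting the competitors to couplings gives the first inequality.  For
    the second, a competitor [P] of the moment problem is replaced by
    [Q = \sum_(i, j) P (T_i `*` T_j) / (mu T_i * nu T_j) *
      (mu \x nu)|_(T_i `*` T_j)],
    which redistributes the mass of each product cell according to [mu \x nu].
    The moment constraints make [Q] a coupling of [mu] and [nu]; [P] and [Q]
    give the same mass to each product cell, on which [c] oscillates by at most
    [K / N]. *)

Require Import Defs.
From HB Require Import structures.
From mathcomp Require Import all_boot all_order all_algebra.
From mathcomp Require Import ring lra.
From mathcomp Require Import all_classical all_reals all_analysis.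
From mathcomp Require Import measurable_realfun.

Set Implicit Arguments.
Unset Strict Implicit.
Unset Printing Implicit Defensive.

Import Order.TTheory GRing.Theory Num.Theory.
Import numFieldNormedType.Exports.
Local Open Scope classical_set_scope.
Local Open Scope ring_scope.
Local Open Scope ereal_scope.

(** * Probabilities carried by a set or by finitely many disjoint sets *)

Lemma probability_setI1 (d : measure_display) (T : measurableType d)
    (R : realType) (P : probability T R) (S E : set T) :
  measurable S -> measurable E -> P S = 1 -> P (E `&` S) = P E.
Proof.
move=> mS mE PS.
have PC : P (~` S) = 0 by rewrite probability_setC// PS subee.
have -> : P E = P (E `&` S) + P (E `\` S).
  by rewrite addeC -measureDI.
have /le_anti -> : (P (E `\` S) <= 0 <= P (E `\` S))%O.
  rewrite measure_ge0 andbT -PC le_measure ?inE//.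
  - exact: measurableD.
  - exact: measurableC.
  - by move=> x [].
by rewrite adde0.
Qed.

(** The union of the disjoint [A i] with [i < N] has full mass, so cutting [E] along it loses
    nothing. *)
Lemma probability_sum_setI (d : measure_display) (T : measurableType d)
    (R : realType) (P : probability T R) (N : nat) (A : nat -> set T)
    (E : set T) :
  (forall i, measurable (A i)) -> trivIset setT A ->
  \sum_(i < N) P (A i) = 1 -> measurable E ->
  \sum_(i < N) P (E `&` A i) = P E.
Proof.
move=> mA tA sA mE.
have tA' : trivIset setT (fun i : 'I_N => A i).
  by move=> i j _ _ /tA ij; apply: val_inj; exact: ij.
have tEA : trivIset setT (fun i : 'I_N => E `&` A i) by exact: trivIset_setIl.
rewrite -measure_bigsetU_ord//; last by move=> i; exact: measurableI.
rewrite -big_distrr/= probability_setI1//; first exact: bigsetU_measurable.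
by rewrite measure_bigsetU_ord.
Qed.

(** * Couplings with prescribed masses on product cells *)

(** Serves to view a measure of total mass 1 as a probability: [mnormalize] carries that structure,
    and its fallback [P] is never reached here. *)
Lemma mnormalize_mass1 (d : measure_display) (T : measurableType d)
    (R : realType) (mu : {measure set T -> \bar R}) (P : probability T R) :
  mu setT = 1 -> mnormalize mu P = mu :> (set T -> \bar R).
Proof.
move=> muT; apply/funext => U.
by rewrite /mnormalize muT onee_eq0/= invr1 mule1.
Qed.

(* Junk value: [n j = 0] forces [p i j = 0], so [p i j / 0 = 0] is harmless. *)
Lemma glue_weights_sum (R : realType) (N : nat) (p : nat -> nat -> R)
    (m n a : nat -> R) :
  (forall i, (i < N)%N -> (\sum_(j < N) p i j)%R = m i) ->
  (forall i j, (i < N)%N -> (j < N)%N -> n j = 0%R -> p i j = 0%R) ->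
  (forall i, (i < N)%N -> m i = 0%R -> a i = 0%R) ->
  (\sum_(i < N) \sum_(j < N) p i j / (m i * n j) * (a i * n j)
    = \sum_(i < N) a i)%R.
Proof.
move=> pm pn ma; apply: eq_bigr => i _.
transitivity (\sum_(j < N) (p i j * (a i / m i)))%R.
  apply: eq_bigr => j _.
  have [n0|n0] := eqVneq (n j) 0%R; first by rewrite pn// !mul0r.
  (* The inverse of [m i] is kept opaque because [m i] may be zero; [field] then has only [n j] to
     invert. *)
  by rewrite invfM; move: (m i)^-1%R => u; field.
rewrite -mulr_suml pm//.
have [m0|m0] := eqVneq (m i) 0%R; first by rewrite ma// m0 !mul0r.
by rewrite mulrC mulfVK.
Qed.

Section glue.
Context (d1 d2 : measure_display) (T1 : measurableType d1)
  (T2 : measurableType d2) (R : realType).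
Variables (mu : probability T1 R) (nu : probability T2 R) (N : nat).
Variables (A : nat -> set T1) (B : nat -> set T2).
Hypotheses (mA : forall i, measurable (A i)) (mB : forall j, measurable (B j)).
Variable w : nat -> nat -> {nonneg R}.

(** Written with [msum], [mscale] and [mrestr] so that the measure structure is inferred; the
    weights [w] stay free until the masses of the cells are known. *)
Definition glue : set (T1 * T2) -> \bar R :=
  msum (fun i => msum (fun j =>
    mscale (w i j) (mrestr (mu \x nu) (measurableX (mA i) (mB j)))) N) N.

HB.instance Definition _ := Measure.on glue.

(** A rectangle meets each product cell in a rectangle, on which the product measure factors. *)
Lemma glue_setX (E : set T1) (F : set T2) : measurable E -> measurable F ->
  glue (E `*` F) =
  \sum_(i < N) \sum_(j < N) (w i j)%:num%:E * (mu (E `&` A i) * nu (F `&` B j)).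
Proof.
move=> mE mF; apply: eq_bigr => i _; apply: eq_bigr => j _.
rewrite /= /mscale /mrestr.
congr (_ * _); rewrite -product_measure1E; [|exact: measurableI..].
by rewrite setXI.
Qed.

End glue.

(** The row sums of the cell masses of [P] are the [mu (A i)]. They cancel that factor of the
    weights, which leaves the mass of [E] inside each [A i] in the first marginal; column sums give
    the second. *)
Lemma exists_coupling (d1 d2 : measure_display) (T1 : measurableType d1)
    (T2 : measurableType d2) (R : realType) (mu : probability T1 R)
    (nu : probability T2 R) (N : nat) (A : nat -> set T1) (B : nat -> set T2)
    (P : probability (T1 * T2)%type R) :
  (forall i, measurable (A i)) -> (forall j, measurable (B j)) ->
  trivIset setT A -> trivIset setT B ->
  \sum_(i < N) mu (A i) = 1 -> \sum_(j < N) nu (B j) = 1 ->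
  (forall i, (i < N)%N -> P (A i `*` setT) = mu (A i)) ->
  (forall j, (j < N)%N -> P (setT `*` B j) = nu (B j)) ->
  exists Q : probability (T1 * T2)%type R,
    [/\ forall E, measurable E -> Q (E `*` setT) = mu E,
        forall F, measurable F -> Q (setT `*` F) = nu F &
        forall i j, (i < N)%N -> (j < N)%N ->
          Q (A i `*` B j) = P (A i `*` B j)].
Proof.
move=> mA mB tA tB sA sB PA PB.
(* All masses are finite; real values allow division and [field]. *)
pose m i := fine (mu (A i)); pose n j := fine (nu (B j)).
pose p i j := fine (P (A i `*` B j)).
have mAB i j : measurable (A i `*` B j) by exact: measurableX.
have Pp i j : P (A i `*` B j) = (p i j)%:E by rewrite fineK// fin_num_measure.
have p_ge0 i j : (0 <= p i j)%R by rewrite fine_ge0.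
have pE i : (i < N)%N -> (\sum_(j < N) p i j)%R = m i.
  move=> iN; apply: EFin_inj; rewrite -sumEFin /m fineK ?fin_num_measure//.
  under eq_bigr do rewrite -Pp.
  (* The strips over the [B j] are disjoint with total [P]-mass 1, since their masses are those of
     [nu]; they therefore split the strip over [A i]. *)
  rewrite -PA// -[RHS](@probability_sum_setI _ _ _ P N (fun j => setT `*` B j)).
  - by apply: eq_bigr => j _; rewrite -setXI setIT setTI.
  - by move=> j; exact: measurableX.
  - by move=> j k _ _ [[x y] [[_ Bj] [_ Bk]]]; apply: tB => //; exists y.
  - by rewrite -sB; apply: eq_bigr => j _; rewrite PB.
  - exact: measurableX.
have pE' j : (j < N)%N -> (\sum_(i < N) p i j)%R = n j.
  move=> jN; apply: EFin_inj; rewrite -sumEFin /n fineK ?fin_num_measure//.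
  under eq_bigr do rewrite -Pp.
  rewrite -PB// -[RHS](@probability_sum_setI _ _ _ P N (fun i => A i `*` setT)).
  - by apply: eq_bigr => i _; rewrite -setXI setIT setTI.
  - by move=> i; exact: measurableX.
  - by move=> i k _ _ [[x y] [[Ai _] [Ak _]]]; apply: tA => //; exists x.
  - by rewrite -sA; apply: eq_bigr => i _; rewrite PA.
  - exact: measurableX.
(* A single nonnegative term of a vanishing sum vanishes. This controls the divisions by zero in the
   weights. *)
have pm i j : (i < N)%N -> (j < N)%N -> m i = 0%R -> p i j = 0%R.
  move=> iN jN m0; apply/eqP; rewrite eq_le p_ge0 andbT -m0 -pE//.
  rewrite (bigD1 (Ordinal jN))//= lerDl; exact: sumr_ge0.
have pn i j : (i < N)%N -> (j < N)%N -> n j = 0%R -> p i j = 0%R.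
  move=> iN jN n0; apply/eqP; rewrite eq_le p_ge0 andbT -n0 -pE'//.
  rewrite (bigD1 (Ordinal iN))//= lerDl; exact: sumr_ge0.
have w_ge0 i j : (0 <= p i j / (m i * n j))%R.
  by rewrite divr_ge0// mulr_ge0// fine_ge0.
pose q := glue mu nu N mA mB (fun i j => NngNum (w_ge0 i j)).
have qE E F : measurable E -> measurable F -> q (E `*` F) =
    (\sum_(i < N) \sum_(j < N) p i j / (m i * n j) *
      (fine (mu (E `&` A i)) * fine (nu (F `&` B j))))%:E.
  move=> mE mF; rewrite /q glue_setX// -sumEFin; apply: eq_bigr => i _.
  rewrite -sumEFin; apply: eq_bigr => j _ /=.
  by rewrite !EFinM !fineK// fin_num_measure//; exact: measurableI.
have sumE E : measurable E -> (\sum_(i < N) fine (mu (E `&` A i)))%:E = mu E.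
  move=> mE; rewrite -[RHS](probability_sum_setI _ _ sA)// -sumEFin.
  by apply: eq_bigr => i _; rewrite fineK// fin_num_measure//;
    exact: measurableI.
have sumF F : measurable F -> (\sum_(j < N) fine (nu (F `&` B j)))%:E = nu F.
  move=> mF; rewrite -[RHS](probability_sum_setI _ _ sB)// -sumEFin.
  by apply: eq_bigr => j _; rewrite fineK// fin_num_measure//;
    exact: measurableI.
have q1 E : measurable E -> q (E `*` setT) = mu E.
  move=> mE; rewrite qE// -sumE//; congr _%:E.
  under eq_bigr do under eq_bigr do rewrite setTI.
  apply: (@glue_weights_sum _ N p m n (fun i => fine (mu (E `&` A i)))) => //.
  (* The part of [E] in a [mu]-null cell is null, by monotonicity. *)
  move=> i iN m0.
  apply/eqP; rewrite eq_le fine_ge0// andbT -m0 fine_le ?fin_num_measure//.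
  - exact: measurableI.
  - by rewrite le_measure ?inE//; exact: measurableI.
have q2 F : measurable F -> q (setT `*` F) = nu F.
  move=> mF; rewrite qE// -sumF//; congr _%:E; rewrite exchange_big/=.
  under eq_bigr do under eq_bigr do
    rewrite setTI [(m _ * _)%R]mulrC [X in (_ * X)%R]mulrC.
  (* After the exchange of sums, this is the first-marginal computation with [p] transposed and [m],
     [n] swapped. *)
  apply: (@glue_weights_sum _ N (fun j i => p i j) n m
    (fun j => fine (nu (F `&` B j)))) => // [i j iN jN|j jN n0].
    by move=> ?; exact: pm.
  apply/eqP; rewrite eq_le fine_ge0// andbT -n0 fine_le ?fin_num_measure//.
  - exact: measurableI.
  - by rewrite le_measure ?inE//; exact: measurableI.
have qT : q setT = 1 by rewrite -setXTT q1// probability_setT.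
have QE U : mnormalize q P U = q U by rewrite (mnormalize_mass1 P qT).
exists (mnormalize q P); split.
- by move=> E mE; apply: etrans (QE _) (q1 _ mE).
- by move=> F mF; apply: etrans (QE _) (q2 _ mF).
move=> i j iN jN; apply: etrans (QE _) _; rewrite qE//.
(* By disjointness only the term of index [(i, j)] survives. *)
rewrite (bigD1 (Ordinal iN))//= [X in (_ + X)%R]big1 => [|k ki]; last first.
  apply: big1 => l _; have [->|/set0P AA] := eqVneq (A i `&` A k) set0.
    by rewrite measure0/= mul0r mulr0.
  by have := tA i k I I AA; move/esym => ik; rewrite -val_eqE/= ik eqxx in ki.
rewrite addr0 (bigD1 (Ordinal jN))//= [X in (_ + X)%R]big1 => [|k kj];
  last first.
  have [->|/set0P BB] := eqVneq (B j `&` B k) set0.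
    by rewrite measure0/= !mulr0.
  by have := tB j k I I BB; move/esym => jk; rewrite -val_eqE/= jk eqxx in kj.
rewrite addr0 !setIid Pp -/(m i) -/(n j); congr _%:E.
(* In a degenerate cell both sides are 0, because [p i j] is. *)
have [m0|m0] := eqVneq (m i) 0%R; first by rewrite pm// !mul0r.
have [n0|n0] := eqVneq (n j) 0%R; first by rewrite pn// !mul0r.
by field; rewrite m0 n0.
Qed.

(** * Partition of the unit interval and square into cells *)

Section cells.
Context (R : realType).
Implicit Types (x y : R) (N m : nat).

(** A division-free form that treats the closed first cell and the half-open others alike. Cells are
    numbered from 0 here, hence the successor. *)
Lemma cellP N m x : (0 < N)%N -> cell N m.+1 x <->
  [/\ (0 <= x)%R, (x * N%:R <= m.+1%:R)%R & m = 0%N \/ (m%:R < x * N%:R)%R].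
Proof.
move=> N0; have N0' : (0 < N%:R :> R)%R by rewrite ltr0n.
rewrite /cell; case: m => [|m] /=; rewrite in_itv/=.
  rewrite -[(N%:R^-1)%R]mul1r ler_pdivlMr//.
  by split=> [/andP[-> ->]|[-> ->]//]; split=> //; left.
rewrite ler_pdivlMr// ltr_pdivrMr//; split=> [/andP[mx ->]|[_ -> []//->//]].
split=> //; last by right.
by rewrite -(pmulr_lge0 _ N0') (le_trans _ (ltW mx)).
Qed.

Lemma measurable_cell N m : measurable (@cell R N m).
Proof. by rewrite /cell; case: ifP. Qed.

Lemma cell_subset_unit_itv N m : (m < N)%N ->
  @cell R N m.+1 `<=` @unit_itv R.
Proof.
move=> mN x; have N0 : (0 < N)%N by exact: leq_ltn_trans mN.
move=> /cellP -/(_ N0)[x0 xm _]; rewrite /unit_itv/= in_itv/= x0/=.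
rewrite -(@ler_pM2r _ N%:R) ?ltr0n// mul1r (le_trans xm)//.
by rewrite ler_nat.
Qed.

(** A common point of cells [i] and [j] gives [i < x * N <= j + 1] unless [i = 0], so [i <= j];
    exchanging the cells gives equality. *)
Lemma trivIset_cell N : (0 < N)%N -> trivIset setT (fun m => @cell R N m.+1).
Proof.
move=> N0.
have le i j x : cell N i.+1 x -> cell N j.+1 x -> (i <= j)%N.
  move=> /cellP -/(_ N0)[_ _ [->//|ix]] /cellP -/(_ N0)[_ xj _].
  by have := lt_le_trans ix xj; rewrite ltr_nat ltnS.
move=> i j _ _ [x [xi xj]]; apply/eqP; rewrite eqn_leq.
by rewrite (le _ _ x)// (le _ _ x).
Qed.

Lemma cell_cover N x : (0 < N)%N -> @unit_itv R x ->
  exists2 m, (m < N)%N & cell N m.+1 x.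
Proof.
move=> N0; rewrite /unit_itv/= in_itv/= => /andP[x0 x1].
have ex : exists m, (x * N%:R <= m.+1%:R)%R.
  by exists N; rewrite (le_trans (ler_piMl _ x1))// ler_nat.
(* The cell of [x] is the least [m] with [x * N <= m + 1]; minimality supplies the strict lower
   bound when [m] is positive. *)
case: (ex_minnP ex) => m xm mmin; exists m.
  rewrite -(prednK N0) ltnS mmin// prednK//.
  by rewrite -[leRHS]mul1r ler_wpM2r.
apply/cellP => //; split=> //; case: m mmin {xm} => [|m] mmin; [by left|right].
by rewrite ltNge; apply/negP => /mmin; rewrite ltnn.
Qed.

Lemma cell_diam N m x y : (0 < N)%N -> cell N m.+1 x -> cell N m.+1 y ->
  (`|x - y| <= N%:R^-1)%R.
Proof.
move=> N0; have N0' : (0 < N%:R :> R)%R by rewrite ltr0n.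
move=> /cellP -/(_ N0)[x0 xm mx] /cellP -/(_ N0)[y0 ym my].
rewrite -[leRHS]mul1r ler_pdivlMr// -[X in (_ * X)%R]gtr0_norm// -normrM.
rewrite mulrBl; have {}mx : (m%:R <= x * N%:R)%R.
  by case: mx => [->|/ltW//]; rewrite mulr_ge0.
have {}my : (m%:R <= y * N%:R)%R.
  by case: my => [->|/ltW//]; rewrite mulr_ge0.
by move: xm ym; rewrite -natr1 ler_norml => *; apply/andP; split; lra.
Qed.

Lemma probability_sum_cell (P : probability (measurableTypeR R) R) N :
  (0 < N)%N -> on_unit_itv P -> \sum_(i < N) P (cell N i.+1) = 1.
Proof.
move=> N0 PI; rewrite -[RHS]PI -(@measure_bigsetU_ord _ _ _ P N xpredT
    (fun i : 'I_N => @cell R N i.+1)).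
- congr (P _); rewrite -(bigcup_mkord N (fun i => cell N i.+1)).
  apply/seteqP; split.
    by move=> x [i iN]; exact: cell_subset_unit_itv.
  by move=> x /(cell_cover N0)[i iN xi]; exists i.
- by move=> i; exact: measurable_cell.
- by move=> i j _ _ /(trivIset_cell N0) ij; apply: val_inj; exact: ij.
Qed.

Definition square_cell N (k : nat * nat) : set (R * R) :=
  cell N k.1.+1 `*` cell N k.2.+1.

Lemma measurable_square_cell N k :
  measurable (square_cell N k : set (measurableTypeR R * measurableTypeR R)).
Proof. by apply: measurableX; exact: measurable_cell. Qed.

Lemma measurable_unit_square :
  measurable (@unit_square R : set (measurableTypeR R * measurableTypeR R)).
Proof. by apply: measurableX; exact: measurable_itv. Qed.

Lemma trivIset_square_cell N : (0 < N)%N -> trivIset setT (square_cell N).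
Proof.
move=> N0 [i j] [i' j'] _ _ [[x y] [[/= xi yj] [/= xi' yj']]].
by congr pair; apply: (trivIset_cell N0) => //; [exists x|exists y].
Qed.

(** A duplicate-free sequence of index pairs, the form in which integrals split over a finite
    disjoint union. *)
Definition grid N : seq (nat * nat) :=
  [seq (i, j) | i <- iota 0 N, j <- iota 0 N].

Lemma grid_uniq N : uniq (grid N).
Proof. by apply: allpairs_uniq; rewrite ?iota_uniq// => -[? ?] [? ?]. Qed.

Lemma mem_grid N i j : ((i, j) \in grid N) = (i < N)%N && (j < N)%N.
Proof.
apply/allpairsP/andP => [[[a b] /= []]|[iN jN]].
  by rewrite !mem_iota => aN bN [-> ->].
by exists (i, j); rewrite !mem_iota.
Qed.

Lemma unit_square_cover N : (0 < N)%N ->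
  @unit_square R = \big[setU/set0]_(k <- grid N) square_cell N k.
Proof.
move=> N0; rewrite -bigcup_seq; apply/seteqP; split=> [[x y] [/= xI yI]|].
  have [i iN xi] := cell_cover N0 xI; have [j jN yj] := cell_cover N0 yI.
  by exists (i, j) => //=; rewrite mem_grid iN.
move=> [x y] [[i j] /=]; rewrite mem_grid => /andP[iN jN] [/= xi yj].
by split; [exact: (cell_subset_unit_itv iN)|exact: (cell_subset_unit_itv jN)].
Qed.

Lemma integral_unit_square (N : nat)
    (P : {measure set (measurableTypeR R * measurableTypeR R) -> \bar R})
    (f : R * R -> R) :
  (0 < N)%N -> measurable_fun
    (@unit_square R : set (measurableTypeR R * measurableTypeR R)) f ->
  (forall p, unit_square p -> (0 <= f p)%R) ->
  \int[P]_(p in @unit_square R) (f p)%:E =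
  \sum_(k <- grid N) \int[P]_(p in square_cell N k) (f p)%:E.
Proof.
move=> N0 mf f0; rewrite (unit_square_cover N0) ge0_integral_bigsetU//.
- exact: measurable_square_cell.
- exact: grid_uniq.
- exact: sub_trivIset (trivIset_square_cell N0).
- by rewrite -(unit_square_cover N0); exact/measurable_EFinP.
- by rewrite -(unit_square_cover N0) => p /f0; rewrite lee_fin.
Qed.

End cells.

(** * Oscillation of a Lipschitz cost on the cells *)

(** A cell has diameter at most [1 / N] in the max norm. The one-sided bound serves both the
    measurability of [c] and the comparison of costs. *)
Lemma square_cell_lipschitz (R : realType) (c : R * R -> R) (K : R) (N : nat)
    (k : nat * nat) (p q : R * R) :
  (0 <= K)%R ->
  (forall p q : R * R, unit_square p -> unit_square q ->
    (`|c p - c q| <= K * Num.max `|p.1 - q.1| `|p.2 - q.2|)%R) ->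
  k \in grid N -> square_cell N k p -> square_cell N k q ->
  (c p <= c q + K / N%:R)%R.
Proof.
case: k p q => [i j] [x y] [x' y'] K0 cK; rewrite mem_grid => /andP[iN jN].
have N0 : (0 < N)%N by exact: leq_ltn_trans iN.
move=> [/= xi yj] [/= xi' yj'].
rewrite -lerBlDl (le_trans (ler_norm _))// (le_trans (cK _ _ _ _))//.
- by split; [exact: (cell_subset_unit_itv iN)|exact: (cell_subset_unit_itv jN)].
- by split; [exact: (cell_subset_unit_itv iN)|exact: (cell_subset_unit_itv jN)].
- rewrite ler_wpM2l// ge_max /=.
  by rewrite (cell_diam N0 xi xi') (cell_diam N0 yj yj').
Qed.

(** Nothing is known of [c] off the square, so measurability is obtained on the square directly,
    from its superlevel sets. *)
Lemma measurable_lipschitz_unit_square (R : realType) (c : R * R -> R) (K : R) :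
  (0 <= K)%R ->
  (forall p q : R * R, unit_square p -> unit_square q ->
    (`|c p - c q| <= K * Num.max `|p.1 - q.1| `|p.2 - q.2|)%R) ->
  measurable_fun
    (@unit_square R : set (measurableTypeR R * measurableTypeR R)) c.
Proof.
move=> K0 cK; apply: (measurability _ (RGenOInfty.measurableE R)) => //.
move=> _ [_ [a ->] <-].
(* [c > a] is relatively open, hence a countable union of cells. *)
rewrite (_ : _ `&` _ = \bigcup_N \bigcup_k
    if `[< k \in grid N.+1 /\ forall p, square_cell N.+1 k p -> (a < c p)%R >]
    then square_cell N.+1 k else set0); last first.
  apply/seteqP; split=> p.
    move=> [Sp /=]; rewrite in_itv/= andbT => acp.
    (* On a grid this fine, [c] cannot drop from [c p] to [a] within the cell of [p]. *)
    have [N _ KN] : exists2 N, True & (K / N.+1%:R < c p - a)%R.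
      exists (Num.truncn (K / (c p - a))) => //.
      rewrite ltr_pdivrMr ?ltr0n// mulrC -ltr_pdivrMr ?subr_gt0//.
      exact: Num.Theory.truncnS_gt.
    have := Sp; rewrite (unit_square_cover R (ltn0Sn N)) -bigcup_seq.
    move=> [k /= kN pk]; exists N => //; exists k => //.
    rewrite ifT//; apply/asboolP; split=> // q qk.
    have := square_cell_lipschitz K0 cK kN pk qk; move: KN;
      set t := (K / _)%R; lra.
  move=> [N _ [k _]]; case: ifPn => // /asboolP[kN ack] pk; split.
    rewrite (unit_square_cover R (ltn0Sn N)) -bigcup_seq; by exists k.
  by rewrite /= in_itv/= andbT ack.
apply: bigcupT_measurable => N; apply: countable_bigcupT_measurable => [|k].
  exact: countableP.
by case: ifPn => // _; exact: measurable_square_cell.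
Qed.

(** Only constants transfer from [Q] to [P] through [Q D = P D]; the supremum [M] of [f] is one
    lying between [f] and [f + e] on [D]. *)
Lemma le_integral_oscillation (d : measure_display) (T : measurableType d)
    (R : realType) (P Q : {measure set T -> \bar R}) (D : set T) (f : T -> R)
    (e : R) :
  measurable D -> measurable_fun D f -> Q D = P D ->
  (forall x, D x -> (0 <= f x)%R) ->
  (forall x y, D x -> D y -> (f x <= f y + e)%R) ->
  \int[Q]_(x in D) (f x)%:E <= \int[P]_(x in D) (f x + e)%:E.
Proof.
move=> mD mf QP f0 fe; pose M := sup (f @` D).
(* For empty [D] the value of [sup] is a default, but the bounds are claimed only at points of
   [D]. *)
have fM x : D x -> (f x <= M)%R.
  move=> Dx; apply: ub_le_sup; last by exists x.
  by exists (f x + e)%R => _ [y Dy <-]; exact: fe.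
have Mf x : D x -> (M <= f x + e)%R.
  move=> Dx; apply: ge_sup; first by exists (f x); exists x.
  by move=> _ [y Dy <-]; exact: fe.
apply: (@le_trans _ _ (M%:E * P D)).
  rewrite -QP -integral_cst//; apply: ge0_le_integral => //.
  exact/measurable_EFinP.
rewrite -integral_cst//; apply: ge0_le_integral => //.
- by move=> x Dx; rewrite lee_fin (le_trans _ (fM _ Dx))// f0.
- apply/measurable_EFinP; exact: measurable_funD.
Qed.

Lemma cost_oscillation (R : realType) (c : R * R -> R) (K : R) (N : nat)
    (P Q : probability (measurableTypeR R * measurableTypeR R)%type R) :
  (0 < N)%N -> (0 <= K)%R ->
  (forall p : R * R, unit_square p -> (0 <= c p)%R) ->
  (forall p q : R * R, unit_square p -> unit_square q ->
    (`|c p - c q| <= K * Num.max `|p.1 - q.1| `|p.2 - q.2|)%R) ->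
  on_unit_square P ->
  (forall k, k \in grid N -> Q (square_cell N k) = P (square_cell N k)) ->
  cost c Q <= cost c P + (K / N%:R)%:E.
Proof.
move=> N0 K0 c0 cK PS QP.
have KN0 : (0 <= K / N%:R)%R by rewrite divr_ge0.
have mS := @measurable_unit_square R.
have mc := measurable_lipschitz_unit_square K0 cK.
have cellS k : k \in grid N -> square_cell N k `<=` @unit_square R.
  by move=> kN p pk; rewrite (unit_square_cover R N0) -bigcup_seq; exists k.
(* The constant enters the integral because [P] gives the square mass 1; the comparison can then be
   made cell by cell. *)
have -> : cost c P + (K / N%:R)%:E =
    \int[P]_(p in @unit_square R) (c p + K / N%:R)%:E.
  under eq_integral do rewrite EFinD.
  rewrite ge0_integralD//=.
  - congr (_ + _); rewrite integral_cst//.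
    by rewrite [X in _ * X](PS : _ = _) mule1.
  - exact/measurable_EFinP.
rewrite /cost !(integral_unit_square _ N0)//.
- rewrite big_seq [leRHS]big_seq; apply: lee_sum => k kN.
  apply: le_integral_oscillation.
  + exact: measurable_square_cell.
  + exact: measurable_funS (cellS _ kN) mc.
  + exact: QP.
  + by move=> p /(cellS _ kN); exact: c0.
  + by move=> p q; exact: square_cell_lipschitz.
- exact: measurable_funD.
- by move=> p /c0 cp; rewrite addr_ge0.
Qed.

(** * Moment constraints as equalities of masses *)

Lemma integral_indic_unit_square (R : realType)
    (P : probability (measurableTypeR R * measurableTypeR R)%type R)
    (f : R * R -> R) (A : set R) :
  measurable_fun [set: measurableTypeR R * measurableTypeR R] f ->
  measurable A -> on_unit_square P ->
  \int[P]_(p in @unit_square R) (\1_A (f p))%:E = P (f @^-1` A).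
Proof.
move=> mf mA PS.
have mfA : measurable (f @^-1` A : set (measurableTypeR R * measurableTypeR R)).
  by rewrite -[X in measurable X]setTI; exact: mf.
under eq_integral => p _.
  rewrite (_ : \1_A (f p) = \1_(f @^-1` A) p); last by rewrite !indicE.
  over.
rewrite integral_indic//; last exact: measurable_unit_square.
by apply: probability_setI1 => //; exact: measurable_unit_square.
Qed.

Lemma integral_cell_indic (R : realType)
    (mu : probability (measurableTypeR R) R) (N m : nat) :
  on_unit_itv mu ->
  \int[mu]_(x in @unit_itv R) (@cell_indic R N m x)%:E = mu (cell N m).
Proof.
move=> muI; rewrite integral_indic//; last exact: measurable_cell.
- apply: probability_setI1 => //; first exact: measurable_itv.
  exact: measurable_cell.
- exact: measurable_itv.
Qed.

(** Integrals of indicators are masses, and the complement of the interval or square is null.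
    Indices now start at 0, as [exists_coupling] expects. *)
Lemma moment_couplings_cellP (R : realType)
    (mu nu : probability (measurableTypeR R) R) (N : nat)
    (P : probability (measurableTypeR R * measurableTypeR R)%type R) :
  on_unit_itv mu -> on_unit_itv nu ->
  moment_couplings mu nu N (@cell_indic R N) (@cell_indic R N) P <->
  on_unit_square P /\ forall i j, (i < N)%N -> (j < N)%N ->
    P (cell N i.+1 `*` setT) = mu (cell N i.+1) /\
    P (setT `*` cell N j.+1) = nu (cell N j.+1).
Proof.
move=> muI nuI; rewrite /moment_couplings/=.
split=> -[PS PH]; split=> //.
  move=> i j iN jN; have := PH i.+1 j.+1 iN jN.
  rewrite !integral_cell_indic// !integral_indic_unit_square//;
    try exact: measurable_cell.
  by rewrite setXT setTX.
(* Index 0 is excluded by the range of the constraints. *)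
move=> [|i] [|j]// iN jN; have := PH i j iN jN.
rewrite !integral_cell_indic// !integral_indic_unit_square//;
  try exact: measurable_cell.
by rewrite setXT setTX.
Qed.

(** * Comparison of the two infima *)

Theorem proposition5p1 (R : realType)
    (mu nu : probability (measurableTypeR R) R)
    (hmu : on_unit_itv mu) (hnu : on_unit_itv nu)
    (c : R * R -> R) (K : R) (hK : (0 < K)%R)
    (hc0 : forall p : R * R, unit_square p -> (0 <= c p)%R)
    (hcK : forall p q : R * R, unit_square p -> unit_square q ->
      (`|c p - c q| <= K * Num.max `|p.1 - q.1| `|p.2 - q.2|)%R)
    (N : nat) (hN : (0 < N)%N) :
  MCOT mu nu c N <= OT mu nu c /\
  OT mu nu c <= MCOT mu nu c N + (K / N%:R)%:E.
Proof.
split.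
  apply: ereal_inf_le_tmp => _ [P [PS P1 P2] <-]; exists P => //.
  apply/moment_couplings_cellP => //; split=> // i j _ _.
  by rewrite setXT setTX; split; [apply: P1|apply: P2]; exact: measurable_cell.
(* With [K / N] on the left, the right side is a bare infimum and the bound is checked for each
   competitor [P]. *)
rewrite -leeBlDr//; apply: le_ereal_inf_tmp => _ [P + <-].
move=> /(moment_couplings_cellP N P hmu hnu)[PS PH].
have [Q [Q1 Q2 QP]] := @exists_coupling _ _ _ _ R mu nu N
  (fun m => cell N m.+1) (fun m => cell N m.+1) P
  (fun i => measurable_cell N i.+1) (fun j => measurable_cell N j.+1)
  (trivIset_cell hN) (trivIset_cell hN)
  (probability_sum_cell hN hmu) (probability_sum_cell hN hnu)
  (fun i iN => proj1 (PH i i iN iN)) (fun j jN => proj2 (PH j j jN jN)).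
rewrite leeBlDr//.
have mI : measurable (@unit_itv R : set (measurableTypeR R)).
  exact: measurable_itv.
(* The square is the intersection of two strips, each of full mass by the marginals of [Q]. *)
have QS : on_unit_square Q.
  rewrite /on_unit_square /unit_square.
  have -> : @unit_itv R `*` @unit_itv R =
      (@unit_itv R `*` setT) `&` (setT `*` @unit_itv R).
    by rewrite -setXI setIT setTI.
  rewrite probability_setI1.
  - by rewrite Q1.
  - exact: measurableX.
  - exact: measurableX.
  - by rewrite Q2.
apply: (@le_trans _ _ (cost c Q)); last first.
  apply: cost_oscillation => //; first exact: ltW.
  by move=> [i j]; rewrite mem_grid => /andP[iN jN]; exact: QP.
apply: ereal_inf_lbound; exists Q => //; split=> // A mA.
- by rewrite /pushforward -setXT Q1.
- by rewrite /pushforward -setTX Q2.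
Qed.
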